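(* The permutation mechanism is $1/2$-optimal. That is, for every finite directed graph $G=(N,E)$ without loops with maximum indegree $\Delta(G)>0$, the vertex $i$ selected from $G$ by the permutation mechanism satisfies $\mathbb{E}[\delta^-(i,G)]\ge \tfrac12\,\Delta(G)$.
   Context: Graphs are finite directed graphs $G=(N,E)$ with vertex set $N=\{1,\dots,n\}$, $n\ge 1$, and $E\subseteq\{(i,j)\in N\times N: i\ne j\}$. For $S\subseteq N$ and $i\in N$, $\delta^-_S(i)=|\{j\in S:(j,i)\in E\}|$ is the indegree of $i$ from $S$; $\delta^-(i,G)=\delta^-(i)=\delta^-_N(i)$; and $\Delta(G)=\max_{i\in N}\delta^-(i,G)$. A selection mechanism maps each graph to a probability distribution on its vertices (the selected vertex is drawn from this distribution). It is $\alpha$-optimal if for every graph $G$ with $\Delta(G)>0$ the expected indegree of the selected vertex is at least $\alpha\,\Delta(G)$. Permutation mechanism. On input $G=(N,E)$ with $|N|=n$: choose a permutation $(\pi_1,\dots,\pi_n)$ of $N$ uniformly at random, and write $\pi_{<j}=\{\pi_1,\dots,\pi_{j-1}\}$. Set $c:=\pi_1$ and $d:=0$. For $j=2,\dots,n$ in this order: if $\delta^-_{\pi_{<j}\setminus\{c\}}(\pi_j)\ge d$, then set $c:=\pi_j$ and $d:=\delta^-_{\pi_{<j}}(\pi_j)$ (otherwise leave $c,d$ unchanged). Return $c$. *)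

(* Defs.v *)
From HB Require Import structures.
From mathcomp Require Import all_boot all_order all_fingroup all_algebra.

Set Implicit Arguments.
Unset Strict Implicit.
Unset Printing Implicit Defensive.

Import Order.TTheory GRing.Theory Num.Theory.

(* The index is shifted so that the vertex set is never empty: [digraph n] is
   the type of loopless directed graphs on n + 1 vertices. *)
Record digraph (n : nat) := Digraph {
  arcs : {set 'I_n.+1 * 'I_n.+1};
  arcs_loopless : forall i j, (i, j) \in arcs -> i != j
}.

Section Indegree.
Variables (n : nat) (G : digraph n).

Definition indeg_from (S : {set 'I_n.+1}) (i : 'I_n.+1) : nat :=
  #|[set j in S | (j, i) \in arcs G]|.

Definition indeg (i : 'I_n.+1) : nat := indeg_from [set: 'I_n.+1] i.

Definition max_indeg : nat := \max_(i < n.+1) indeg i.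

End Indegree.

Section PermutationRun.
Variables (n : nat) (G : digraph n) (s : {perm 'I_n.+1}).

(* Positions are numbered from 0, so [s ord0] is the first vertex of the
   permutation and [before j] collects those preceding position [j]. *)
Definition before (j : 'I_n.+1) : {set 'I_n.+1} :=
  [set s k | k : 'I_n.+1 & (k < j)%N].

Definition perm_step (cd : 'I_n.+1 * nat) (j : 'I_n.+1) : 'I_n.+1 * nat :=
  let: (c, d) := cd in
  if (d <= indeg_from G (before j :\ c) (s j))%N
  then (s j, indeg_from G (before j) (s j))
  else (c, d).

(* [enum] lists the ordinals in increasing order. *)
Definition perm_select : 'I_n.+1 :=
  (foldl perm_step (s ord0, 0%N) [seq j <- enum 'I_n.+1 | j != ord0]).1.

End PermutationRun.

Local Open Scope ring_scope.

Record fdist (R : realFieldType) (T : finType) := FDist {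
  pmf : {ffun T -> R};
  pmf_ge0 : forall x, 0 <= pmf x;
  pmf_sum1 : \sum_x pmf x = 1
}.

Definition expectation (R : realFieldType) (T : finType) (P : fdist R T)
  (f : T -> R) : R := \sum_x pmf P x * f x.

Definition selection_mechanism (R : realFieldType) : Type :=
  forall n : nat, digraph n -> fdist R 'I_n.+1.

Definition optimal (R : realFieldType) (alpha : R)
    (M : selection_mechanism R) : Prop :=
  forall (n : nat) (G : digraph n), (0 < max_indeg G)%N ->
    alpha * (max_indeg G)%:R <= expectation (M n G) (fun i => (indeg G i)%:R).

Section PermutationMechanism.
Variables (R : realFieldType) (n : nat) (G : digraph n).

(* The law of the selected vertex when the permutation is uniform. *)
Definition perm_pmf : {ffun 'I_n.+1 -> R} :=
  [ffun i => #|[set s : {perm 'I_n.+1} | perm_select G s == i]|%:R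
             / #|{perm 'I_n.+1}|%:R].

Lemma perm_pmf_ge0 i : 0 <= perm_pmf i.
Proof. by rewrite ffunE divr_ge0 ?ler0n. Qed.

Lemma perm_pmf_sum1 : \sum_i perm_pmf i = 1.
Proof.
under eq_bigr do rewrite ffunE.
rewrite -mulr_suml -natr_sum.
have -> : (\sum_i #|[set s : {perm 'I_n.+1} | perm_select G s == i]|
           = #|{perm 'I_n.+1}|)%N.
  rewrite -sum1_card (partition_big (perm_select G) xpredT) //=.
  by apply: eq_bigr => i _; rewrite -sum1_card; apply: eq_bigl => s; rewrite inE.
rewrite divff // pnatr_eq0 -lt0n; apply/card_gt0P.
by exists (1%g : {perm 'I_n.+1}).
Qed.

End PermutationMechanism.

Definition permutation_mechanism (R : realFieldType) : selection_mechanism R :=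
  fun n G => FDist (perm_pmf_ge0 R G) (perm_pmf_sum1 R G).

(* Main.v *)
Require Import Defs.
From mathcomp Require Import all_boot all_order all_fingroup all_algebra.
Import Order.TTheory GRing.Theory Num.Theory.
Local Open Scope ring_scope.

(** Let v have maximum indegree. The threshold d never decreases and never
    exceeds the indegree of the current candidate c. When v is examined, either
    it becomes the candidate, or d exceeds its indegree from its predecessors
    other than c; in both cases d is afterwards at least the indegree of v from
    all its predecessors. So the selected vertex has at least this indegree,
    whose mean is half the indegree of v: reversing the permutation exchanges
    predecessors and successors of v. *)

Section Run.
Set Implicit Arguments.
Unset Strict Implicit.
Variables (n : nat) (G : digraph n).
Implicit Types (s : {perm 'I_n.+1}) (S T : {set 'I_n.+1}).
Implicit Types (c i j v w : 'I_n.+1).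

Lemma indeg_from_subset S T i :
  S \subset T -> (indeg_from G S i <= indeg_from G T i)%N.
Proof.
move=> /subsetP sST; apply/subset_leq_card/subsetP => j.
by rewrite !inE => /andP[/sST -> ->].
Qed.

Lemma indeg_from_setD1 S c i :
  (indeg_from G S i <= (indeg_from G (S :\ c) i).+1)%N.
Proof.
rewrite /indeg_from (cardsD1 c) -[leqRHS]add1n leq_add ?leq_b1 //.
by apply/subset_leq_card/subsetP => j; rewrite !inE andbA.
Qed.

(** Dropping [c] from the predecessors costs at most one arc, and when the test fails the strict
    inequality makes up for it. *)
Lemma perm_step_threshold s (cd : 'I_n.+1 * nat) j :
  (maxn cd.2 (indeg_from G (before s j) (s j)) <= (perm_step G s cd j).2)%N.
Proof.
case: cd => c d; rewrite /perm_step geq_max; case: ifPn => /= [le_d | ].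
  by rewrite leqnn andbT (leq_trans le_d) ?indeg_from_subset ?subD1set.
by rewrite leqnn -ltnNge; apply/leq_trans/indeg_from_setD1.
Qed.

Lemma perm_step_indeg s (cd : 'I_n.+1 * nat) j :
  (cd.2 <= indeg G cd.1)%N ->
  ((perm_step G s cd j).2 <= indeg G (perm_step G s cd j).1)%N.
Proof.
case: cd => c d; rewrite /perm_step; case: ifP => //= _ _.
exact/indeg_from_subset/subsetT.
Qed.

Lemma foldl_perm_step_indeg s (cd : 'I_n.+1 * nat) js :
  (cd.2 <= indeg G cd.1)%N ->
  ((foldl (perm_step G s) cd js).2
     <= indeg G (foldl (perm_step G s) cd js).1)%N.
Proof.
elim: js cd => //= j js IHjs cd le_cd.
exact/IHjs/perm_step_indeg.
Qed.

Lemma foldl_perm_step_ge s (cd : 'I_n.+1 * nat) js :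
  (cd.2 <= (foldl (perm_step G s) cd js).2)%N.
Proof.
elim: js cd => //= j js IHjs cd; apply: leq_trans (IHjs _).
by have := perm_step_threshold s cd j; rewrite geq_max => /andP[].
Qed.

Lemma foldl_perm_step_threshold s (cd : 'I_n.+1 * nat) js j :
  j \in js ->
  (indeg_from G (before s j) (s j) <= (foldl (perm_step G s) cd js).2)%N.
Proof.
elim: js cd => //= k js IHjs cd; rewrite inE => /orP[/eqP-> | /IHjs //].
apply: leq_trans (foldl_perm_step_ge _ _ _).
by have := perm_step_threshold s cd k; rewrite geq_max => /andP[].
Qed.

Lemma mem_before s j w : (w \in before s j) = (s^-1%g w < j)%N.
Proof.
apply/imsetP/idP => [[k] | lt_wj].
  by rewrite inE => lt_kj ->; rewrite permK.
by exists (s^-1%g w); rewrite ?inE ?permKV.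
Qed.

Definition indeg_before s v : nat := indeg_from G (before s (s^-1%g v)) v.

Lemma indeg_perm_select s v : (indeg_before s v <= indeg G (perm_select G s))%N.
Proof.
apply: leq_trans (@foldl_perm_step_indeg s (s ord0, 0%N) _ (leq0n _)).
(* The fold skips position [ord0], but a vertex placed there has no predecessors, so the bound is
   0. *)
have [j0 | j_neq0] := eqVneq (s^-1%g v) ord0.
  rewrite (_ : indeg_before s v = 0%N) //.
  by apply: eq_card0 => w; rewrite !inE mem_before j0 ltn0.
rewrite /indeg_before -[X in indeg_from _ _ X](permKV s v).
by apply: foldl_perm_step_threshold; rewrite mem_filter j_neq0 mem_enum.
Qed.

(** The left factor acts first, so positions are reversed and the vertices are listed backwards. *)
Definition rev_perm s : {perm 'I_n.+1} := (perm rev_ord_inj * s)%g.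

Lemma rev_permK : involutive rev_perm.
Proof. by move=> s; apply/permP=> i; rewrite !permM !permE rev_ordK. Qed.

Lemma rev_permV s w : (rev_perm s)^-1%g w = rev_ord (s^-1%g w).
Proof.
apply: (@perm_inj _ (rev_perm s)).
by rewrite permKV permM permE rev_ordK permKV.
Qed.

Lemma indeg_before_rev s v :
  (indeg_before s v + indeg_before (rev_perm s) v)%N = indeg G v.
Proof.
have rev_ltE w : ((rev_perm s)^-1%g w < (rev_perm s)^-1%g v)%N
                 = (s^-1%g v < s^-1%g w)%N.
  by rewrite !rev_permV /= ltn_sub2lE ?ltn_ord.
(* The in-neighbours before [v] and those after it are disjoint; as [v] has no loop, they are all
   its in-neighbours. *)
rewrite /indeg /indeg_before /indeg_from -cardsUI addnC eq_card0 => [|w].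
  apply: eq_card => w; rewrite !inE !mem_before rev_ltE -andb_orl.
  apply: andb_idl => /arcs_loopless.
  by rewrite -neq_ltn (inj_eq val_inj) (inj_eq perm_inj).
by rewrite !inE !mem_before rev_ltE; case: ltngtP; rewrite ?andbF.
Qed.

(** Reversal is a bijection on permutations: reindexing one of two copies of the sum by it pairs
    each [s] with [rev_perm s]. *)
Lemma sum_indeg_before v :
  ((\sum_s indeg_before s v).*2 = #|{perm 'I_n.+1}| * indeg G v)%N.
Proof.
rewrite -addnn {2}(reindex_inj (can_inj rev_permK)) -big_split /=.
by under eq_bigr do rewrite indeg_before_rev; rewrite sum_nat_const.
Qed.

(** Group the permutations by the vertex they select. *)
Lemma expectation_permutation_mechanism (R : realFieldType) (f : 'I_n.+1 -> R) :
  expectation (permutation_mechanism R G) f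
    = (\sum_s f (perm_select G s)) / #|{perm 'I_n.+1}|%:R.
Proof.
rewrite (partition_big (perm_select G) xpredT) //= mulr_suml.
apply: eq_bigr => i _; rewrite ffunE mulrAC; congr (_ / _).
under eq_bigr => s /eqP -> do [].
rewrite sumr_const mulr_natl; congr (_ *+ _).
by apply: eq_card => s; rewrite !inE.
Qed.

End Run.

Theorem theorem4 (R : realFieldType) :
  optimal (1 / 2 : R) (permutation_mechanism R).
Proof.
move=> n G _; rewrite expectation_permutation_mechanism.
have [|v max_v] := @bigop.eq_bigmax _ (indeg G); first by rewrite card_ord.
rewrite /max_indeg max_v.
have perm_gt0 : 0 < #|{perm 'I_n.+1}|%:R :> R.
  by rewrite ltr0n; apply/card_gt0P; exists 1%g.
(* Clearing denominators leaves twice a sum on each side, compared permutation by permutation. *)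
rewrite mul1r ler_pdivlMr // -mulrA ler_pdivrMl ?ltr0n //.
rewrite -natr_sum -!natrM ler_nat mulnC -sum_indeg_before mul2n leq_double.
by apply: leq_sum => s _; apply: indeg_perm_select.
Qed.
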